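(* Let $1\le\alpha<\infty$ and let $\psi\colon(0,1]\to(0,+\infty)$ be an essentially decreasing continuous function such that $x\mapsto x^{\alpha}\psi(x)$ is bounded on $(0,1]$ and for every $\delta>0$, $\liminf_{x\to+0}x^{\delta}\psi(x)=0$. Set $g(x)=x^{\alpha}\psi(x)$ for $0<x\le1$ and $g(0)=0$. Suppose $\mathbf{E}_g$ is an equivalence relation. Then $\mathbf{E}_{\mathrm{Id}^{\alpha}}\le_B\mathbf{E}_g$.
   Context: For $f\colon[0,1]\to[0,\infty)$, $\mathbf{E}_f$ is the relation on $[0,1]^{\omega}$ given by $(x_n)\,\mathbf{E}_f\,(y_n)\iff\sum_{n<\omega}f(|y_n-x_n|)<\infty$. $\mathrm{Id}^{\alpha}$ is the function $x\mapsto x^{\alpha}$ on $[0,1]$. A function $\psi\colon(0,1]\to[0,\infty)$ is essentially decreasing if there is $C\ge1$ such that $x\le y$ implies $C\psi(x)\ge\psi(y)$ for all $x,y\in(0,1]$. For equivalence relations $E$ on a Polish space $X$ and $F$ on a Polish space $Y$, $E\le_B F$ means there is a Borel function $\vartheta\colon X\to Y$ with $x\,E\,x'\iff\vartheta(x)\,F\,\vartheta(x')$ for all $x,x'\in X$. *)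

(* Defs.v *)
From HB Require Import structures.
From mathcomp Require Import all_boot all_order all_algebra.
From mathcomp Require Import all_classical all_reals all_analysis.

Set Implicit Arguments.
Unset Strict Implicit.
Unset Printing Implicit Defensive.

Import Order.TTheory GRing.Theory Num.Theory.
Import numFieldNormedType.Exports.

Local Open Scope classical_set_scope.
Local Open Scope ring_scope.

(* The space [0,1]^omega: [0,1] has the subspace topology (it is a [set_type])
   and the sequences have the topology of pointwise convergence, i.e. the
   product topology. *)
Definition unit_cube (R : realType) : topologicalType :=
  {ptws nat -> (`[0%R, 1%R]%classic : set R)}.

(* A function on [0,1] is represented by a total function on R. Only its values
   on [0,1] matter below, because |y_n - x_n| lies in [0,1]. The sum is taken in
   the extended reals: it has a limit as soon as f is nonnegative on [0,1]. *)
Definition Erel (R : realType) (f : R -> R) (x y : unit_cube R) : Prop :=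
  (\sum_(0 <= n <oo) (f `|set_val (y n) - set_val (x n)|)%:E < +oo)%E.

Definition Idpow (R : realType) (alpha : R) : R -> R := fun x => x `^ alpha.

Definition essentially_decreasing (R : realType) (psi : R -> R) : Prop :=
  exists2 C : R, 1 <= C &
    {in `]0, 1] &, forall x y, x <= y -> psi y <= C * psi x}.

Definition pow_mul (R : realType) (alpha : R) (psi : R -> R) : R -> R :=
  fun x => if x == 0 then 0 else x `^ alpha * psi x.

Definition borel_set (X : topologicalType) (A : set X) : Prop :=
  <<s (@open X) >> A.

(* [measurable_fun] is not used because the sigma-algebra structure on
   [g_sigma_algebraType] requires a pointed type. *)
Definition borel_fun (X Y : topologicalType) (theta : X -> Y) : Prop :=
  forall B : set Y, borel_set B -> borel_set (theta @^-1` B).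

Definition borel_reducible (X Y : topologicalType)
    (E : X -> X -> Prop) (F : Y -> Y -> Prop) : Prop :=
  exists2 theta : X -> Y, borel_fun theta &
    forall x x' : X, E x x' <-> F (theta x) (theta x').

(* Main.v *)
(* Write g(x) = x^alpha psi(x). Since psi is not bounded below by any function
   c x^(-delta), for each n there is eps_n with
   psi(eps_n 2^-(n+1)) <= 2 psi(eps_n). With N_n about 1 / g(eps_n), essential
   monotonicity of psi makes N_n g(eps_n t) comparable to t^alpha, uniformly in
   n, for all t in [2^-(n+1), 1]. So round x_n down to a multiple of 2^-n, which
   costs a summable error and makes every nonzero difference at least 2^-n,
   multiply by eps_n and repeat the result N_n times. Each coordinate of the
   image depends on one integer code of the argument, whence the map is Borel. *)

Require Import Defs.
From HB Require Import structures.
From mathcomp Require Import all_boot all_order all_algebra.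
From mathcomp Require Import all_classical all_reals all_analysis.
From mathcomp Require Import ring lra.

Import Order.TTheory GRing.Theory Num.Theory.
Import numFieldNormedType.Exports.

Local Open Scope classical_set_scope.
Local Open Scope ring_scope.

Set Implicit Arguments.
Unset Strict Implicit.

(** * Borel sets, and Borel maps determined by integer codes *)

Lemma borel_setC (X : topologicalType) (A : set X) :
  borel_set A -> borel_set (~` A).
Proof. by rewrite -setTD; exact: sigma_algebraCD. Qed.

Lemma borel_set0 (X : topologicalType) : borel_set (set0 : set X).
Proof. exact: sigma_algebra0. Qed.

Lemma borel_bigcup (X : topologicalType) (A : nat -> set X) :
  (forall i, borel_set (A i)) -> borel_set (\bigcup_i A i).
Proof. by move=> mA; exact: sigma_algebra_bigcup. Qed.

Lemma borel_setI (X : topologicalType) (A B : set X) :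
  borel_set A -> borel_set B -> borel_set (A `&` B).
Proof.
move=> mA mB; rewrite -[A `&` B]setCK setCI -bigcup2E; apply: borel_setC.
apply: borel_bigcup => -[|[|i]] /=; [exact: borel_setC..|].
exact: borel_set0.
Qed.

(** By induction on [m], splitting on the value of the last code. [P] can be an arbitrary predicate
    because there are only countably many prefixes. *)
Lemma borel_prefix (X : topologicalType) (c : nat -> X -> nat) :
  (forall i k, borel_set [set x | c i x = k]) ->
  forall m (P : seq nat -> Prop), borel_set [set x | P (mkseq (c^~ x) m)].
Proof.
move=> mc; elim=> [|m IH] P.
  have [P0|P0] := pselect (P [::]).
    rewrite (_ : [set _ | _] = ~` set0); last first.
      by rewrite setC0; apply/seteqP; split.
    by apply: borel_setC; exact: borel_set0.
  rewrite (_ : [set _ | _] = set0); first exact: borel_set0.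
  by apply/seteqP; split.
rewrite (_ : [set _ | _] = \bigcup_k ([set x | c m x = k] `&`
    [set x | P (rcons (mkseq (c^~ x) m) k)])).
  refine (borel_bigcup (fun k => borel_setI (mc m k) _)).
  exact: (IH (fun s => P (rcons s k))).
apply/seteqP; split=> [x /=|x [k _ [/= <-]]]; rewrite mkseqS //.
by move=> Px; exists (c m x).
Qed.

(* The preimage of an open set is a countable union of sets that are described by
   finitely many codes. *)
Lemma borel_fun_prefix (X Y : topologicalType) (theta : X -> Y)
    (c : nat -> X -> nat) :
  (forall i k, borel_set [set x | c i x = k]) ->
  (forall (U : set Y) x, open U -> U (theta x) ->
     exists m, forall x', (forall i, (i < m)%N -> c i x' = c i x) ->
       U (theta x')) ->
  borel_fun theta.
Proof.
move=> mc locU B mB.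
suff : (@open Y) `<=` image_set_system setT theta (@borel_set X).
  move=> sB; have := smallest_sub (sigma_algebra_image theta _) sB mB.
  by rewrite /image_set_system /= setTI; apply; exact: smallest_sigma_algebra.
move=> U oU; rewrite /image_set_system /= setTI.
(* [good m] quantifies over all points with prefix [s], so it is a predicate on the prefix alone, as
   [borel_prefix] requires. *)
pose good m (s : seq nat) := forall x', mkseq (c^~ x') m = s -> U (theta x').
rewrite (_ : _ @^-1` _ = \bigcup_m [set x | good m (mkseq (c^~ x) m)]).
  by refine (borel_bigcup (fun m => borel_prefix mc m (good m))).
apply/seteqP; split=> [x Ux|x [m _]]; last exact.
have [m mU] := locU U x oU Ux; exists m => // x' eqx'.
apply: mU => i im; rewrite -(nth_mkseq 0 (c^~ x') im) eqx'.
by rewrite nth_mkseq.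
Qed.

(** A subbasic neighbourhood constrains one coordinate [k], which is constant from [(d k).+1] on.
    This serves to show that the reduction depends locally on finitely many codes. *)
Lemma cvg_ptws_eventually_eq (T : topologicalType) (z_ : nat -> {ptws nat -> T})
    (z : {ptws nat -> T}) (d : nat -> nat) :
  (forall k m, (d k < m)%N -> z_ m k = z k) -> z_ @ \oo --> z.
Proof.
move=> zE; apply/cvg_sup => k A; rewrite nbhsE => -[_ [[V oV <-] Vz] VA].
exists (d k).+1 => // m /= dm; apply: VA; rewrite /= zE //.
Qed.

Lemma borel_code (R : realType) (i k : nat) :
  borel_set [set x : unit_cube R | Num.truncn (2 ^+ i * set_val (x i)) = k].
Proof.
pose h (x : unit_cube R) : R := 2 ^+ i * set_val (x i).
have cont : continuous h.
  have c1 : continuous (fun x : unit_cube R => x i).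
    exact: (@proj_continuous nat (fun=> `[0%R, 1%R]%classic : set R) i).
  have c2 : continuous (fun x : unit_cube R => set_val (x i) : R).
    move=> x; exact: continuous_comp (c1 x) (@initial_continuous _ _ set_val _).
  move=> x; exact: continuous_comp (c2 x) (@mulrl_continuous _ _ _).
have h0 x : 0 <= h x.
  have := set_valP (x i); rewrite /= in_itv /= => /andP[? _].
  by rewrite mulr_ge0 // exprn_ge0.
(* The truncation of [h x] is [k] iff k <= h x < k + 1, as [h] is nonnegative. *)
rewrite (_ : [set _ | _] =
    ~` (h @^-1` [set t | t < k%:R]) `&` h @^-1` [set t | t < k.+1%:R]).
  apply borel_setI; [apply borel_setC|]; apply: sub_sigma_algebra;
    by apply: open_comp => [x _|]; [exact: cont|exact: open_lt].
apply/seteqP; split=> x /=.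
  move=> <-; have /andP[/le_gtF ? ?] := truncn_itv (h0 x).
  by split=> //; apply/negP/negbT.
by move=> [/negP]; rewrite -leNgt => ? ?; apply: truncn_def; apply/andP.
Qed.

(** * Series of nonnegative terms *)

(** Nonnegative terms may be rearranged along [e] into rows indexed by [i]; row [i] holds [N i]
    copies of [a i] and zeros elsewhere. *)
Lemma nneseries_blocks (R : realType) (e : nat -> nat * nat) (N : nat -> nat)
    (a : nat -> R) :
  bijective e -> (forall i, 0 <= a i) ->
  (\sum_(0 <= m <oo)
     (if ((e m).2 < N (e m).1)%N then a (e m).1 else 0)%:E =
   \sum_(0 <= i <oo) ((N i)%:R * a i)%:E)%E.
Proof.
move=> bije a0.
pose h i j : \bar R := (if (j < N i)%N then a i else 0)%:E.
have h0 i j : (0 <= h i j)%E by rewrite lee_fin; case: ifP.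
have Na i : (0 <= ((N i)%:R * a i)%:E :> \bar R)%E by rewrite lee_fin mulr_ge0.
rewrite nneseries_esumT; last by move=> m; exact: h0.
rewrite nneseries_esumT //.
rewrite (_ : (fun i => ((N i)%:R * a i)%:E) =
    fun i => (\esum_(j in setT) h i j)%E).
  rewrite esum_esum // (_ : setT `*`` _ = [set: nat * nat]); last first.
    by apply/seteqP; split.
  apply/esym; apply: (@reindex_esum _ _ _ setT setT e (fun k => h k.1 k.2)).
  by rewrite setTT_bijective.
apply/funext => i; rewrite -nneseries_esumT // (nneseries_split 0 (N i)) //.
rewrite add0n [X in (_ + X)%E]eseries0 ?adde0.
  rewrite big_mkord (eq_bigr (fun=> (a i)%:E)).
    by rewrite sumEFin sumr_const card_ord mulr_natl.
  by move=> j _; rewrite /h ltn_ord.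
by move=> j Nj _; rewrite /h ltnNge Nj.
Qed.

(** The geometric term leaves room for the rounding errors, whose sum is finite. *)
Lemma dominated_series (R : realType) (u v : nat -> R) (K : R) :
  0 <= K -> (forall n, 0 <= u n) -> (forall n, 0 <= v n) ->
  (forall n, u n <= K * (v n + 2^-1 ^+ n)) ->
  (\sum_(0 <= n <oo) (v n)%:E < +oo)%E -> (\sum_(0 <= n <oo) (u n)%:E < +oo)%E.
Proof.
move=> K0 u0 v0 uv sv.
apply: (@le_lt_trans _ _
    (\sum_(0 <= n <oo) (K%:E * ((v n)%:E + (2^-1 ^+ n)%:E)))%E).
  by apply: lee_nneseries => [n _ _|n _]; rewrite -?EFinD -?EFinM lee_fin.
have h0 n : (0 <= (2^-1 ^+ n)%:E :> \bar R)%E by rewrite lee_fin exprn_ge0.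
rewrite nneseriesZl; last first.
  by move=> n _; rewrite -EFinD lee_fin addr_ge0 // exprn_ge0.
rewrite nneseriesD //; try by move=> n _ _; rewrite ?h0 ?lee_fin.
have sh : (\sum_(0 <= n <oo) (2^-1 ^+ n)%:E < +oo :> \bar R)%E.
  have /cvg_lim := @cvg_geometric_eseries_half R 2 0.
  rewrite (_ : (fun n => (2 / (2 ^ (n + 1))%:R)%:E) =
    fun n => (2^-1 ^+ n)%:E :> \bar R) => [->//|].
    by rewrite ltry.
  apply/funext => n; congr EFin.
  by rewrite natrX addn1 exprS invfM mulrA divff // mul1r exprVn.
rewrite lte_mul_pinfty // ?lee_fin // lte_add_pinfty //.
Qed.


(** * Power estimates and scales at which [psi] grows slowly *)

(** Here a <= 2 max(b, c), and c^alpha <= c since c <= 1 <= alpha. The error thus enters linearly,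
    ready for [dominated_series]. *)
Lemma powR_le_add (R : realType) (alpha a b c : R) :
  1 <= alpha -> 0 <= a -> 0 <= b -> 0 <= c <= 1 -> a <= b + c ->
  a `^ alpha <= 2 `^ alpha * (b `^ alpha + c).
Proof.
move=> al1 a0 b0 /andP[c0 c1] abc.
have al0 : 0 <= alpha by rewrite (le_trans ler01).
have nn (x : R) : 0 <= x -> x \is Num.nneg by rewrite nnegrE.
have cc : c `^ alpha <= c.
  move: c0; rewrite le_eqVlt => /predU1P[<-|c0].
    by rewrite powR0 // gt_eqF // (lt_le_trans ltr01).
  by apply: ge1r_powR => //; apply/andP.
have m0 : 0 <= Num.max b c by rewrite le_max b0.
apply: (@le_trans _ _ ((2 * Num.max b c) `^ alpha)).
  apply: ge0_ler_powR; rewrite ?nn ?mulr_ge0 //.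
  by rewrite (le_trans abc) // mulr_natl mulr2n lerD // le_max lexx ?orbT.
rewrite powRM // ler_pM2l ?powR_gt0 //.
case: (leP b c) => _; last by rewrite lerDl.
by rewrite (le_trans cc) // ler_wpDl ?powR_ge0.
Qed.

(** Otherwise [psi] more than doubles from each q^n to q^(n+1), so it grows at least like a negative
    power of x, against the liminf hypothesis. *)
Lemma slow_scale (R : realType) (psi : R -> R) (q : R) :
  0 < q < 1 -> (forall x, x \in `]0, 1] -> 0 < psi x) ->
  essentially_decreasing psi ->
  (forall delta : R, 0 < delta ->
     limf_einf (fun x : R => (x `^ delta * psi x)%:E) 0^'+ = 0%E) ->
  exists2 eps, eps \in `]0, 1] & psi (eps * q) <= 2 * psi eps.
Proof.
move=> /andP[q0 q1] psi0 [C C1 psiC] psi_liminf.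
apply: contrapT => noeps.
have qn_itv n : q ^+ n \in `]0, 1].
  by rewrite in_itv /= exprn_gt0 ?exprn_ile1 // ltW.
have growth n : 2 ^+ n * psi 1 <= psi (q ^+ n).
  elim: n => [|n IH]; first by rewrite !expr0 mul1r.
  rewrite exprS -mulrA (@le_trans _ _ (2 * psi (q ^+ n))) ?ler_pM2l //.
  rewrite leNgt exprSr; apply/negP => /ltW h; apply: noeps.
  by exists (q ^+ n).
(* The exponent for which q^delta = 1/2, so that x^delta offsets the doubling of [psi]. *)
pose delta := - ln 2 / ln q.
have lnq0 : ln q < 0 by rewrite ln_lt0 // q0.
have delta0 : 0 < delta.
  by rewrite /delta mulNr -mulrN mulr_gt0 ?ln_gt0 ?ltr1n // oppr_gt0 invr_lt0.
have qdelta n : (q ^+ n) `^ delta = 2^-1 ^+ n.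
  rewrite -powR_mulrn ?ltW // -powRrM mulrC powRrM powR_mulrn ?powR_ge0 //.
  congr (_ ^+ _); rewrite /powR gt_eqF // /delta mulfVK ?lt_eqF //.
  by rewrite expRN lnK // posrE.
have lower x : x \in `]0, 1] -> psi 1 / (2 * C) <= x `^ delta * psi x.
  move=> x01; move: (x01); rewrite in_itv /= => /andP[x0 x1].
  have [k kP] : exists k, q ^+ k < x.
    have /cvgrPdist_lt/(_ x x0) : (q ^+ n @[n --> \oo] --> 0).
      by apply: cvg_expr; rewrite gtr0_norm.
    case=> k _ /(_ k (leqnn k)); rewrite sub0r normrN gtr0_norm ?exprn_gt0 //.
    by exists k.
  have exk : exists k, q ^+ k < x by exists k.
  (* Now q^(m+1) < x <= q^m: the left end bounds x^delta below, the right end bounds psi x below up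
     to [C]. The mismatch of one step costs the factor 2. *)
  case: (ex_minnP exk) => -[|m]; first by rewrite expr0 ltNge x1.
  move=> mx mmin; have xm : x <= q ^+ m.
    by rewrite leNgt; apply/negP => /mmin; rewrite ltnn.
  have h1 : 2^-1 ^+ m.+1 <= x `^ delta.
    rewrite -qdelta; apply: ge0_ler_powR; rewrite ?nnegrE ?ltW //.
    by rewrite exprn_gt0.
  have h2 : 2 ^+ m * psi 1 / C <= psi x.
    rewrite ler_pdivrMr ?(lt_le_trans ltr01) // mulrC [leRHS]mulrC.
    by rewrite mulrC (le_trans (growth m)) // psiC.
  have psi1 : 0 < psi 1 by apply: psi0; rewrite in_itv /= ltr01 lexx.
  have -> : psi 1 / (2 * C) = 2^-1 ^+ m.+1 * (2 ^+ m * psi 1 / C).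
    rewrite exprS invfM !mulrA -(mulrA 2^-1) -exprMn mulVf // expr1n mulr1.
    by rewrite (mulrC (psi 1)).
  apply: ler_pM => //.
  by rewrite !mulr_ge0 ?invr_ge0 ?exprn_ge0 ?ltW // (lt_le_trans ltr01).
have psi1 : 0 < psi 1 by apply: psi0; rewrite in_itv /= ltr01 lexx.
have : ((psi 1 / (2 * C))%:E <=
    limf_einf (fun x : R => (x `^ delta * psi x)%:E) 0^'+)%E.
  (* The liminf is a supremum of infima over sets of the filter, one of which is ]0, 1]. *)
  rewrite limf_einfE; apply: (@le_trans _ _ (ereal_inf
      ((fun x : R => (x `^ delta * psi x)%:E) @` [set` `]0, 1]]))).
    by apply/ereal_infP => _ [x /= x01 <-]; rewrite lee_fin lower.
  apply: ereal_sup_ubound.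
  exists [set` `]0, 1]] => //.
  near=> x; rewrite /= in_itv /=; apply/andP; split; near: x.
    exact: nbhs_right_gt.
  exact: nbhs_right_le.
rewrite psi_liminf // lee_fin leNgt divr_gt0 // mulr_gt0 //.
by rewrite (lt_le_trans ltr01).
Unshelve. all: by end_near.
Qed.

(** [K] is chosen before [q], so one constant serves all coordinates. Dividing by t^alpha leaves N
    eps^alpha psi(eps t), where psi(eps t) is within constant factors of psi(eps). *)
Lemma scaled_copies (R : realType) (alpha : R) (psi : R -> R) :
  (forall x : R, x \in `]0, 1] -> 0 < psi x) ->
  essentially_decreasing psi ->
  [bounded x `^ alpha * psi x | x in (`]0%R, 1%R] : set R)] ->
  (forall delta : R, 0 < delta ->
     limf_einf (fun x : R => (x `^ delta * psi x)%:E) 0^'+ = 0%E) ->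
  exists2 K : R, 1 <= K &
  forall q, 0 < q < 1 -> exists (eps : R) (N : nat),
    eps \in `]0, 1] /\ forall t, q <= t <= 1 ->
      t `^ alpha <= K * (N%:R * pow_mul alpha psi (eps * t)) /\
      N%:R * pow_mul alpha psi (eps * t) <= K * t `^ alpha.
Proof.
move=> psi0 psi_ed [M0 [_ psiM0]] psi_liminf.
pose M := Num.max M0 0 + 1.
have M1 : 1 <= M by rewrite lerDr le_max lexx orbT.
have gM x : x \in `]0, 1] -> x `^ alpha * psi x <= M.
  move=> x01; rewrite (le_trans (ler_norm _)) //.
  by apply: psiM0 => //; rewrite ltr_pwDr // le_max lexx.
have [C C1 psiC] := psi_ed.
have C0 : 0 < C := lt_le_trans ltr01 C1.
have M_0 : 0 < M := lt_le_trans ltr01 M1.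
exists (2 * C * (1 + M)).
  by rewrite !mulr_ege1 ?ler1n // lerDl ltW.
move=> q q01; have [q0 q1] := andP q01.
have [eps eps01 psiq] := slow_scale q01 psi0 psi_ed psi_liminf.
move: (eps01); rewrite in_itv /= => /andP[eps0 eps1].
pose g := eps `^ alpha * psi eps.
have g0 : 0 < g by rewrite mulr_gt0 ?powR_gt0 ?psi0.
(* The least integer above 1/g, whence 1 <= N g <= 1 + g <= 1 + M. *)
exists eps, (Num.truncn g^-1).+1; split=> // t /andP[qt t1].
have t0 : 0 < t := lt_le_trans q0 qt.
set N : R := (Num.truncn g^-1).+1%:R.
have [Ng1 NgM] : 1 <= N * g /\ N * g <= 1 + M.
  have [gi0 /andP[gl gu]] : 0 <= g^-1 /\ (Num.truncn g^-1)%:R <= g^-1 < N.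
    by split; [|apply: truncn_itv]; rewrite invr_ge0 ltW.
  split; first by rewrite -ler_pdivrMr // mul1r ltW.
  rewrite /N -natr1 mulrDl mul1r lerD ?gM //.
  by rewrite -ler_pdivlMr // mul1r.
have N0 : 0 <= N by rewrite ler0n.
have et0 : 0 < eps * t by rewrite mulr_gt0.
have et_eps : eps * t <= eps by rewrite ler_piMr // ltW.
have et01 : eps * t \in `]0, 1] by rewrite in_itv /= et0 (le_trans et_eps).
have eq01 : eps * q \in `]0, 1].
  by rewrite in_itv /= mulr_gt0 //= mulr_ile1 // ltW.
have -> : pow_mul alpha psi (eps * t) =
    t `^ alpha * (eps `^ alpha * psi (eps * t)).
  by rewrite /pow_mul gt_eqF // powRM ?ltW // mulrA (mulrC (t `^ _)).
have ta0 : 0 < t `^ alpha by rewrite powR_gt0.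
have ea0 : 0 < eps `^ alpha by rewrite powR_gt0.
have lo : psi eps <= C * psi (eps * t) by apply: psiC.
(* Essential monotonicity moves from eps t down to eps q, where the choice of [eps] applies. *)
have hi : psi (eps * t) <= 2 * C * psi eps.
  apply: (@le_trans _ _ (C * psi (eps * q))).
    by apply: psiC; rewrite // ler_pM2l.
  by rewrite mulrAC [leRHS]mulrC ler_pM2l.
split.
  rewrite (mulrCA N) (mulrCA _ (t `^ _)) ler_peMr ?(ltW ta0) //.
  rewrite (le_trans Ng1) // (_ : 2 * C * (1 + M) * _ =
    (2 * (1 + M)) * (N * (eps `^ alpha * (C * psi (eps * t))))); last first.
    by ring.
  apply: (@le_trans _ _ (N * (eps `^ alpha * (C * psi (eps * t))))).
    by rewrite ler_wpM2l // ler_pM2l.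
  apply: ler_peMl; first by rewrite !mulr_ge0 // ltW // psi0.
  by rewrite mulr_ege1 ?ler1n // lerDl ltW.
rewrite (mulrCA N) mulrC ler_pM2r //.
apply: (@le_trans _ _ (2 * C * (N * g))).
  rewrite /g (mulrCA _ N) ler_wpM2l // (mulrCA _ (eps `^ _)) ler_pM2l //.
by rewrite ler_pM2l // mulr_gt0.
Qed.

(** * Dyadic rounding *)

Definition dyadic (R : realType) (i : nat) (v : R) : R :=
  (Num.truncn (2 ^+ i * v))%:R / 2 ^+ i.

Lemma dyadic_itv (R : realType) i (v : R) : 0 <= v ->
  dyadic i v <= v < dyadic i v + 2^-1 ^+ i.
Proof.
move=> v0; have p0 : 0 < 2 ^+ i :> R by rewrite exprn_gt0.
have /andP[lo hi] := @truncn_itv _ (2 ^+ i * v) (mulr_ge0 (ltW p0) v0).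
rewrite /dyadic ler_pdivrMr // [v * _]mulrC lo /=.
by rewrite exprVn -[X in _ + X]mul1r -mulrDl natr1 ltr_pdivlMr // [v * _]mulrC.
Qed.

Lemma dyadic_ge0 (R : realType) i (v : R) : 0 <= dyadic i v.
Proof. by rewrite divr_ge0 // exprn_ge0. Qed.

(** Both rounding errors lie in [0, 2^-i), so they differ by less than 2^-i. *)
Lemma dyadic_dist (R : realType) i (v w : R) : 0 <= v -> 0 <= w ->
  `| `|dyadic i v - dyadic i w| - `|v - w| | <= 2^-1 ^+ i.
Proof.
move=> v0 w0; rewrite (le_trans (ler_dist_dist _ _)) //.
have /andP[vl vh] := dyadic_itv i v0; have /andP[wl wh] := dyadic_itv i w0.
by rewrite ler_norml; apply/andP; split; lra.
Qed.

Lemma natr_dist_ge1 (R : realDomainType) (m n : nat) :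
  m != n -> 1 <= `|m%:R - n%:R : R|.
Proof.
rewrite neq_ltn => /orP[]mn; first rewrite distrC.
  by rewrite -natrB 1?ltnW // normr_nat ler1n subn_gt0.
by rewrite -natrB 1?ltnW // normr_nat ler1n subn_gt0.
Qed.

Lemma dyadic_sep (R : realType) i (v w : R) :
  dyadic i v != dyadic i w -> 2^-1 ^+ i <= `|dyadic i v - dyadic i w|.
Proof.
have p0 : 0 < 2 ^+ i :> R by rewrite exprn_gt0.
rewrite /dyadic -mulrBl normrM.
rewrite (gtr0_norm (_ : 0 < (2 ^+ i)^-1)) ?invr_gt0 // => ne.
rewrite exprVn ler_peMl ?invr_ge0 ?(ltW p0) //.
apply: natr_dist_ge1; by apply: contraNN ne => /eqP ->.
Qed.

(** * The reduction *)

Unset Implicit Arguments.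
Set Strict Implicit.

Theorem theorem15 (R : realType) (alpha : R) (psi : R -> R)
  (alpha_ge1 : 1 <= alpha)
  (psi_gt0 : forall x : R, x \in `]0, 1] -> 0 < psi x)
  (psi_ed : essentially_decreasing psi)
  (psi_cont : {within `]0%R, 1%R], continuous psi})
  (psi_bnd : [bounded x `^ alpha * psi x | x in (`]0%R, 1%R] : set R)])
  (psi_liminf : forall delta : R, 0 < delta ->
     limf_einf (fun x : R => (x `^ delta * psi x)%:E) 0^'+ = 0%E)
  (Eg_equiv : RelationClasses.Equivalence (Erel (pow_mul alpha psi))) :
  borel_reducible (Erel (Idpow alpha)) (Erel (pow_mul alpha psi)).
Proof.
have al0 : 0 < alpha := lt_le_trans ltr01 alpha_ge1.
have [K K1 copies] := scaled_copies psi_gt0 psi_ed psi_bnd psi_liminf.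
have K0 : 0 <= K := le_trans ler01 K1.
have half0 : 0 < 2^-1 :> R by rewrite invr_gt0.
have half1 : 2^-1 < 1 :> R by rewrite invf_lt1 // ltr1n.
have h01 i : 0 < (2^-1 : R) ^+ i.+1 < 1.
  by rewrite exprn_gt0 // exprn_ilt1 // ltW.
(* [p i] is the pair (eps_i, N_i). The exponent is [i.+1] because [scaled_copies] needs q < 1 even
   for i = 0. *)
have /choice[p pP] i : exists p : R * nat, p.1 \in `]0, 1] /\
    forall t, 2^-1 ^+ i.+1 <= t <= 1 ->
    t `^ alpha <= K * (p.2%:R * pow_mul alpha psi (p.1 * t)) /\
    p.2%:R * pow_mul alpha psi (p.1 * t) <= K * t `^ alpha.
  by have [eps [N epsN]] := copies _ (h01 i); exists (eps, N).
pose g := pow_mul alpha psi.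
have g0 t : 0 <= t <= 1 -> 0 <= g t.
  move=> /andP[t0 t1]; rewrite /g /pow_mul; case: eqVneq => [//|tn0].
  by rewrite mulr_ge0 ?powR_ge0 // ltW // psi_gt0 // in_itv /= t1 lt_def tn0 t0.
have [e ebij] : exists e : nat -> nat * nat, bijective e.
  have := card_nat2; rewrite card_eq_sym => /card_set_bijP[e].
  by rewrite setTT_bijective => ebij; exists e.
pose val_ (x : unit_cube R) n : R := set_val (x n).
have val01 x n : 0 <= val_ x n <= 1.
  by have := set_valP (x n); rewrite /= in_itv.
pose D (x : unit_cube R) i := dyadic i (val_ x i).
have D01 x i : 0 <= D x i <= 1.
  have /andP[v0 v1] := val01 x i; rewrite dyadic_ge0 /=.
  by have /andP[/le_trans + _] := dyadic_itv i v0; apply.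
(* Coordinate [m] stands for the pair [e m] = (i, j) and holds copy j of eps_i D x i when j < N_i.
   Other coordinates are 0 for every [x] and contribute g(0) = 0. *)
pose th x m := if ((e m).2 < (p (e m).1).2)%N
  then (p (e m).1).1 * D x (e m).1 else 0.
have th01 x m : (`[0, 1]%classic : set R) (th x m).
  rewrite /= in_itv /= /th; case: ifP => _; last by rewrite lexx ler01.
  have [/[1!in_itv]/= /andP[e0 e1] _] := pP (e m).1.
  have /andP[D0 D1] := D01 x (e m).1.
  by rewrite mulr_ge0 ?(ltW e0) //= mulr_ile1 // ltW.
pose theta (x : unit_cube R) : unit_cube R :=
  fun m => SigSub (mem_set (th01 x m)).
pose code i (x : unit_cube R) := Num.truncn (2 ^+ i * set_val (x i)).
exists theta.
  apply: (@borel_fun_prefix _ _ _ code).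
    exact: borel_code.
  (* If no prefix length works, points [z m] sharing [m] codes with [x] have images outside [U].
     Those images converge to [theta x], since coordinate [k] uses only code [(e k).1]: a
     contradiction. *)
  move=> U x oU Ux; apply: contrapT => /forallNP noU.
  have /choice[z zP] m : exists x' : unit_cube R, (forall i, (i < m)%N ->
      code i x' = code i x) /\ ~ U (theta x').
    by have /existsNP[x' /not_implyP[h1 h2]] := noU m; exists x'.
  have : (theta \o z) @ \oo --> theta x.
    apply: (@cvg_ptws_eventually_eq _ _ _ (fun k => (e k).1)) => k m km.
    apply: val_inj => /=; rewrite /th; case: ifP => // _.
    rewrite /D /dyadic -/(code (e k).1 (z m)) -/(code (e k).1 x).
    by rewrite (proj1 (zP m)).
  move=> /(_ U (open_nbhs_nbhs (conj oU Ux)))[m _ /(_ m (leqnn m))].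
  exact: (proj2 (zP m)).
move=> x y.
pose t i := `|D y i - D x i|.
pose u i : R := (p i).2%:R * g ((p i).1 * t i).
have t01 i : 0 <= t i <= 1.
  have /andP[? ?] := D01 x i; have /andP[? ?] := D01 y i.
  rewrite normr_ge0 /t ler_norml /=.
  by apply/andP; split; lra.
have pt01 i : 0 <= (p i).1 * t i <= 1.
  have [/[1!in_itv]/= /andP[e0 e1] _] := pP i; have /andP[t0 t1] := t01 i.
  by rewrite mulr_ge0 ?(ltW e0) //= mulr_ile1 // ltW.
have u0 i : 0 <= u i by rewrite mulr_ge0 ?g0.
have tu i : t i `^ alpha <= K * u i /\ u i <= K * t i `^ alpha.
  (* Equal roundings make both sides 0. Distinct ones differ by at least 2^-i, inside the range
     covered by [pP]. *)
  have [Dxy|Dxy] := eqVneq (D y i) (D x i).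
    rewrite /u /t Dxy subrr normr0 mulr0 powR0 ?gt_eqF // /g /pow_mul eqxx.
    by rewrite !mulr0.
  apply: (proj2 (pP i)); have /andP[_ ->] := t01 i; rewrite andbT.
  by rewrite (le_trans _ (dyadic_sep Dxy)) // exprS ler_piMl ?exprn_ge0 //; lra.
have -> : Erel g (theta x) (theta y) <-> (\sum_(0 <= i <oo) (u i)%:E < +oo)%E.
  rewrite /Erel -(nneseries_blocks (fun i => (p i).2) ebij); last first.
    by move=> i; exact: g0.
  under [X in (X < _)%E <-> _]eq_eseriesr => m _.
    rewrite (_ : g _ = if ((e m).2 < (p (e m).1).2)%N
      then g ((p (e m).1).1 * t (e m).1) else 0); first over.
    rewrite !set_valE /= /th; case: ifP => _.
      rewrite -mulrBr normrM gtr0_norm //.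
      by have [/[1!in_itv]/= /andP[]] := pP (e m).1.
    by rewrite subrr normr0 /g /pow_mul eqxx.
  by [].
pose b i := `|val_ y i - val_ x i|.
have bt i : b i <= t i + 2^-1 ^+ i /\ t i <= b i + 2^-1 ^+ i.
  have /andP[x0 _] := val01 x i; have /andP[y0 _] := val01 y i.
  have := dyadic_dist i y0 x0; rewrite -/(t i) -/(b i) ler_norml => /andP[? ?].
  by split; lra.
have b0 i : 0 <= b i by exact: normr_ge0.
have c01 i : 0 <= (2^-1 : R) ^+ i <= 1 by rewrite exprn_ge0 ?exprn_ile1 //; lra.
have t0 i : 0 <= t i by exact: normr_ge0.
have A0 : 0 <= 2 `^ alpha by exact: powR_ge0.
have c0 : 0 <= K * 2 `^ alpha by rewrite mulr_ge0.
have ub i : u i <= K * 2 `^ alpha * (b i `^ alpha + 2^-1 ^+ i).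
  have [_ /le_trans] := tu i; apply; rewrite -mulrA ler_wpM2l //.
  by apply: powR_le_add => //; case: (bt i).
(* The factor [K], needed only to pass from t^alpha to [u], is also put on the error term, as K >=
   1. *)
have bu i : b i `^ alpha <= K * 2 `^ alpha * (u i + 2^-1 ^+ i).
  have [bti _] := bt i; have [tui _] := tu i; have /andP[ci _] := c01 i.
  rewrite (le_trans (powR_le_add alpha_ge1 (b0 i) (t0 i) (c01 i) bti)) //.
  by rewrite (mulrC K) -mulrA ler_wpM2l // mulrDr lerD // ler_peMl.
split.
  by apply: (dominated_series c0 u0 _ ub) => i; exact: powR_ge0.
by apply: (dominated_series c0 _ u0 bu) => i; exact: powR_ge0.
Qed.
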